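(* Let $\mathbf{f}(\mathbf{x})=\{f_1,\dots,f_n\}\subset\mathbb{R}[x_1,\dots,x_n]$ be a zero-dimensional smooth complete intersection, let $\boldsymbol{\varepsilon}(\mathbf{x})=\{\varepsilon_1,\dots,\varepsilon_n\}\subset\mathbb{R}[x_1,\dots,x_n]$ be an admissible perturbation of $\mathbf{f}(\mathbf{x})$, and let $p\in\mathbb{R}^n$, $p\neq 0$, be a real solution of $\mathbf{f}(\mathbf{x})=0$. Let $\|\cdot\|$ be an induced matrix norm (and also the vector norm on $\mathbb{R}^n$ inducing it), and assume that $\|\mathrm{Jac}_{\mathbf{f}}(p)^{-1}\mathrm{Jac}_{\boldsymbol{\varepsilon}}(p)\|<1$. Then $$\frac{\|\Delta p^1\|}{\|p\|}\le \Lambda(\mathbf{f},\boldsymbol{\varepsilon},p)\;\kappa(\mathbf{f},p)\left(\frac{\|\mathrm{Jac}_{\boldsymbol{\varepsilon}}(p)\|}{\|\mathrm{Jac}_{\mathbf{f}}(p)\|}+\frac{\|\boldsymbol{\varepsilon}(0)-\boldsymbol{\varepsilon}^{\ge 2}(0,p)\|}{\|\mathbf{f}(0)-\mathbf{f}^{\ge 2}(0,p)\|}\right).$$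
   Context: A set $\mathbf{f}=\{f_1,\dots,f_n\}\subset\mathbb{R}[x_1,\dots,x_n]$ generating an ideal $I$ is a zero-dimensional complete intersection if $\dim(\mathbb{R}[\mathbf{x}]/I)=0$; it is smooth if the scheme it defines is smooth, so in particular $\mathrm{Jac}_{\mathbf{f}}(p)$ (the $n\times n$ Jacobian matrix at $p$) is invertible at every real zero $p$. Notation: $\Lambda(\mathbf{f},\boldsymbol{\varepsilon},p)=1/(1-\|\mathrm{Jac}_{\mathbf{f}}(p)^{-1}\mathrm{Jac}_{\boldsymbol{\varepsilon}}(p)\|)$; $\Delta p^1=-\mathrm{Jac}_{\mathbf{f}+\boldsymbol{\varepsilon}}(p)^{-1}\boldsymbol{\varepsilon}(p)$; the local condition number is $\kappa(\mathbf{f},p)=\|\mathrm{Jac}_{\mathbf{f}}(p)^{-1}\|\,\|\mathrm{Jac}_{\mathbf{f}}(p)\|$. For $g\in\mathbb{R}[\mathbf{x}]$, $g^{\ge d}(\mathbf{x},p)=\sum_{|\eta|\ge d}\frac{1}{\eta!}\frac{\partial^\eta g}{\partial\mathbf{x}^\eta}(p)(\mathbf{x}-p)^\eta$ (the part of degree $\ge d$ of the Taylor expansion at $p$), and $\mathbf{f}^{\ge 2}(0,p)$, $\boldsymbol{\varepsilon}^{\ge 2}(0,p)$ are the vectors obtained componentwise and evaluated at $\mathbf{x}=0$. The matrix norm induced by a vector norm is $\|M\|=\max_{\|v\|=1}\|Mv\|$. Admissible perturbation: let $I=(\mathbf{f})$, let $F(\mathbf{a},\mathbf{x})\subset\mathbb{R}[\mathbf{a},\mathbf{x}]$,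 $\mathbf{a}=(a_1,\dots,a_m)$, be a family of $n$ polynomials, generating an ideal $I(\mathbf{a},\mathbf{x})$ with $I(\mathbf{a},\mathbf{x})\cap\mathbb{R}[\mathbf{a}]=(0)$, with $F(\alpha_I,\mathbf{x})=\mathbf{f}(\mathbf{x})$ for some $\alpha_I\in\mathbb{R}^m$, and whose generic member is a zero-dimensional complete intersection. Let $\mathcal{U}\subseteq\mathbb{A}^m_{\mathbb{R}}$ be a dense Zariski-open subscheme containing $\alpha_I$ which is $I$-optimal, meaning that over $\mathcal{U}$ the morphism $\operatorname{Spec}(\mathbb{R}[\mathbf{a},\mathbf{x}]/I(\mathbf{a},\mathbf{x}))\to\mathbb{A}^m_{\mathbb{R}}$ is free and smooth (all fibers are zero-dimensional smooth complete intersections). Let $\mathcal{V}$ be an open semi-algebraic subset of $\mathcal{U}$ with $\alpha_I\in\mathcal{V}$ such that for every $\alpha\in\mathcal{V}$ the number of real roots of $F(\alpha,\mathbf{x})=0$ equals the number $\mu_{\mathbb{R},I}$ of real solutions of $\mathbf{f}(\mathbf{x})=0$. Then $\boldsymbol{\varepsilon}(\mathbf{x})$ is an admissible perturbation of $\mathbf{f}(\mathbf{x})$ if there exists $\alpha\in\mathcal{V}$ with $(\mathbf{f}+\boldsymbol{\varepsilon})(\mathbf{x})=F(\alpha,\mathbf{x})$. *)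

(* Defs.v *)
From HB Require Import structures.
From mathcomp Require Import all_boot all_order all_algebra.
From mathcomp Require Import ring_quotient.
From mathcomp Require Import boolp classical_sets cardinality reals topology.
From mathcomp Require Import mpoly.

Set Implicit Arguments.
Unset Strict Implicit.
Unset Printing Implicit Defensive.

Import Order.TTheory GRing.Theory Num.Theory.
Import numFieldTopology.Exports.

Local Open Scope ring_scope.
Local Open Scope classical_set_scope.
Local Open Scope card_scope.

Definition in_ideal (A : comNzRingType) (n : nat) (f : 'I_n -> A) (g : A) :=
  exists h : 'I_n -> A, g = \sum_i h i * f i.

(* [idealr_closed] includes properness. *)
Definition prime_ideal (A : comNzRingType) (P : {pred A}) :=
  idealr_closed P /\ prime_idealr_closed P.

(* P 0 < P 1 < ... < P d; the primes of A / (f) are the primes of A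
   containing f. *)
Definition prime_chain (A : comNzRingType) (n : nat) (f : 'I_n -> A)
    (d : nat) :=
  exists P : nat -> {pred A},
    (forall k, (k <= d)%N -> prime_ideal (P k) /\ forall i, f i \in P k) /\
    (forall k, (k < d)%N ->
       {subset P k <= P k.+1} /\ exists2 g, g \in P k.+1 & g \notin P k).

Definition quotient_krull_dim (A : comNzRingType) (n : nat) (f : 'I_n -> A)
    (d : nat) :=
  prime_chain f d /\ ~ prime_chain f d.+1.

Definition zero_dim_complete_intersection (K : fieldType) (n : nat)
    (f : 'I_n -> {mpoly K[n]}) :=
  quotient_krull_dim f 0.

Definition square_zero_ideal (A : comNzRingType) (J : {pred A}) :=
  idealr_closed J /\ {in J &, forall u v, u * v = 0}.

Definition lifts_zeros (A : comNzRingType) (J : {pred A}) (n : nat)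
    (g : 'I_n -> {mpoly A[n]}) :=
  forall y : 'I_n -> A, (forall i, (g i).@[y] \in J) ->
    exists2 y' : 'I_n -> A,
      (forall j, y' j - y j \in J) & (forall i, (g i).@[y'] = 0).

(* Smoothness of Spec (K[x] / (f)) over Spec K in the sense of EGA IV, 17.3.1:
   it is of finite presentation, and every K-algebra morphism
   K[x] / (f) -> C / J with J^2 = 0 lifts to C. *)
Definition smooth_scheme (K : fieldType) (n : nat)
    (f : 'I_n -> {mpoly K[n]}) :=
  forall (C : comAlgType K) (J : {pred C}), square_zero_ideal J ->
    lifts_zeros J (fun i => map_mpoly (in_alg C) (f i)).

Definition smooth_zero_dim_complete_intersection (K : fieldType) (n : nat)
    (f : 'I_n -> {mpoly K[n]}) :=
  zero_dim_complete_intersection f /\ smooth_scheme f.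

(* For a family F(a, x), K[a, x] is encoded as K[a][x]. *)
Definition fiber (K A : comNzRingType) (iota : K -> A) (m n : nat)
    (F : 'I_n -> {mpoly {mpoly K[m]}[n]}) (c : 'I_m -> A) :
    'I_n -> {mpoly A[n]} :=
  fun i => map_mpoly (mmap iota c) (F i).

(* A set U of polynomials in a stands for the Zariski-open subscheme of affine
   m-space that is the union of the D(s), s in U. Its A-valued points are the
   c such that the s(c), s in U, generate the unit ideal of A. *)
Definition zopen_point (K A : comNzRingType) (iota : K -> A) (m : nat)
    (U : set {mpoly K[m]}) (c : 'I_m -> A) :=
  exists (r : nat) (s : 'I_r -> {mpoly K[m]}),
    (forall i, U (s i)) /\ in_ideal (fun i => mmap iota c (s i)) 1.

(* It meets D(g) for every g != 0. *)
Definition zopen_dense (K : fieldType) (m : nat) (U : set {mpoly K[m]}) :=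
  forall g : {mpoly K[m]}, g != 0 -> exists2 s, U s & s * g != 0.

Definition smooth_over (K : fieldType) (m n : nat)
    (F : 'I_n -> {mpoly {mpoly K[m]}[n]}) (U : set {mpoly K[m]}) :=
  forall (C : comAlgType K) (J : {pred C}), square_zero_ideal J ->
    forall c : 'I_m -> C, zopen_point (in_alg C) U c ->
      lifts_zeros J (fiber (in_alg C) F c).

(* A regular function on the preimage of U in Spec (K[a, x] / (F)): on the
   preimage of D(s), s in U, it is the fraction (sigma s).1 / s ^+ (sigma s).2,
   and these agree on overlaps. *)
Definition regular_section (K : fieldType) (m n : nat)
    (F : 'I_n -> {mpoly {mpoly K[m]}[n]}) (U : set {mpoly K[m]})
    (sigma : {mpoly K[m]} -> {mpoly {mpoly K[m]}[n]} * nat) :=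
  forall s t, U s -> U t -> exists N,
    in_ideal F ((s * t) ^+ N *:
      (t ^+ (sigma t).2 *: (sigma s).1 - s ^+ (sigma s).2 *: (sigma t).1)).

(* The direct image of the structure sheaf is free over U: it has a basis of
   sections, i.e. sections e_1, ..., e_r that on each D(s) form a basis of
   (K[a, x] / (F))_s over K[a]_s. The powers of s in the denominators are units
   there and can be dropped. The rank is finite because the fibers are
   zero-dimensional. *)
Definition free_over (K : fieldType) (m n : nat)
    (F : 'I_n -> {mpoly {mpoly K[m]}[n]}) (U : set {mpoly K[m]}) :=
  exists (r : nat)
    (e : 'I_r -> {mpoly K[m]} -> {mpoly {mpoly K[m]}[n]} * nat),
    (forall k, regular_section F U (e k)) /\
    forall s, U s ->
      (forall g, exists (N : nat) (b : 'I_r -> {mpoly K[m]}),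
         in_ideal F (s ^+ N *: g - \sum_k b k *: (e k s).1)) /\
      (forall b : 'I_r -> {mpoly K[m]},
         in_ideal F (\sum_k b k *: (e k s).1) ->
         forall k, exists N, s ^+ N * b k = 0).

Section Perturbation.
Variables (R : realType) (n : nat).
Implicit Types f eps : 'I_n -> {mpoly R[n]}.

Definition pt (m : nat) (x : 'cV[R]_m) : 'I_m -> R := fun i => x i 0.

Definition real_fiber (m : nat) (F : 'I_n -> {mpoly {mpoly R[m]}[n]})
    (alpha : 'cV[R]_m) : 'I_n -> {mpoly R[n]} :=
  fiber idfun F (pt alpha).

Definition real_zeros f : set 'cV[R]_n :=
  [set x | forall i, (f i).@[pt x] = 0].

(* "Generic": for all alpha outside a proper Zariski-closed subset. *)
Definition generic_family_containing (m : nat)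
    (F : 'I_n -> {mpoly {mpoly R[m]}[n]}) (alphaI : 'cV[R]_m) f :=
  [/\ forall b : {mpoly R[m]}, in_ideal F b%:MP -> b = 0,
      forall i, real_fiber F alphaI i = f i
    & exists2 h : {mpoly R[m]}, h != 0 &
        forall alpha : 'cV[R]_m, h.@[pt alpha] != 0 ->
          zero_dim_complete_intersection (real_fiber F alpha)].

Definition optimal_over (m : nat) (F : 'I_n -> {mpoly {mpoly R[m]}[n]})
    (U : set {mpoly R[m]}) :=
  [/\ free_over F U, smooth_over F U
    & forall (K : fieldType) (iota : {rmorphism R -> K}) (c : 'I_m -> K),
        zopen_point iota U c ->
        smooth_zero_dim_complete_intersection (fiber iota F c)].

Definition semialgebraic (m : nat) (V : set 'cV[R]_m) :=
  exists D : seq (seq {mpoly R[m]} * seq {mpoly R[m]}),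
    V = [set x | has (fun c => all (fun g => g.@[pt x] == 0) c.1
                            && all (fun g => 0 < g.@[pt x]) c.2) D].

Definition admissible_perturbation f eps :=
  exists (m : nat) (F : 'I_n -> {mpoly {mpoly R[m]}[n]})
    (alphaI : 'cV[R]_m) (U : set {mpoly R[m]}) (V : set 'cV[R]_m),
    [/\ generic_family_containing F alphaI f,
        [/\ zopen_dense U, zopen_point idfun U (pt alphaI)
          & optimal_over F U],
        [/\ open V, semialgebraic V, V alphaI,
            V `<=` [set alpha | zopen_point idfun U (pt alpha)]
          & forall alpha, V alpha ->
              real_zeros (real_fiber F alpha) #= real_zeros f]
      & exists2 alpha, V alpha &
          forall i, f i + eps i = real_fiber F alpha i].

End Perturbation.

Section Conditioning.
Variables (R : realType) (n : nat).
Implicit Types (f eps : 'I_n -> {mpoly R[n]}) (p x : 'cV[R]_n).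

Definition is_norm (N : 'cV[R]_n -> R) :=
  [/\ forall v, N v = 0 -> v = 0,
      forall a v, N (a *: v) = `|a| * N v
    & forall u v, N (u + v) <= N u + N v].

(* The supremum is a maximum, the unit sphere being compact. *)
Definition opnorm (N : 'cV[R]_n -> R) (M : 'M[R]_n) : R :=
  sup [set N (M *m v) | v in [set v | N v = 1]].

Definition evalv f x : 'cV[R]_n := \col_i (f i).@[pt x].

Definition jacobian f p : 'M[R]_n := \matrix_(i, j) ((f i)^`M(j)).@[pt p].

(* The derivatives of order >= msize g vanish. *)
Definition taylor_ge (d : nat) (g : {mpoly R[n]}) x p : R :=
  \sum_(eta : 'X_{1..n < msize g} | (d <= mdeg eta)%N)
     ((\prod_i (eta i)`!)%N%:R)^-1 * (g^`M[eta]).@[pt p]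
       * \prod_i (x i 0 - p i 0) ^+ eta i.

Definition taylor_gev (d : nat) f x p : 'cV[R]_n :=
  \col_i taylor_ge d (f i) x p.

Definition Lambda N f eps p : R :=
  1 / (1 - opnorm N (invmx (jacobian f p) *m jacobian eps p)).

Definition Delta1 f eps p : 'cV[R]_n :=
  - (invmx (jacobian (fun i => f i + eps i) p) *m evalv eps p).

Definition kappa N f p : R :=
  opnorm N (invmx (jacobian f p)) * opnorm N (jacobian f p).

End Conditioning.

(* Main.v *)
Require Import Defs.
From HB Require Import structures.
From mathcomp Require Import all_boot all_order all_algebra qpoly.
From mathcomp Require Import boolp classical_sets reals topology.
From mathcomp Require normed_module matrix_normedtype.
From mathcomp Require Import mpoly.
From mathcomp Require Import ring lra.

(** Since [f] vanishes at [p], the Taylor expansions of [f] and [eps] at [p],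
    evaluated at the origin, give
      f(0) - f^{>=2}(0,p)     = - Jf p,
      eps(0) - eps^{>=2}(0,p) = eps(p) - Je p,
    where Jf and Je are the Jacobian matrices at [p] ([evalv0_sub_taylor]).
    Write w for the second vector and A = Jf^{-1} Je. Then
      Delta1 = - (Jf + Je)^{-1} eps(p) = - (1 + A)^{-1} Jf^{-1} (w + Je p),
    and ||(1 + A)^{-1}|| <= 1 / (1 - ||A||) = Lambda ([neumann_bound]), so
      ||Delta1|| <= Lambda ||Jf^{-1}|| (||w|| + ||Je|| ||p||).
    Dividing by ||p|| and using ||Jf p|| <= ||Jf|| ||p|| to bound ||w|| / ||p||
    by ||Jf|| ||w|| / ||Jf p|| gives the theorem.

    Two facts have to be supplied for this computation.

    The operator norm is a supremum, so the inequality ||M v|| <= ||M|| ||v||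
    needs the supremum to be taken over a bounded set. This follows from the
    comparison of an arbitrary norm with the coordinates
    ([coord_le_is_norm]), a consequence of the compactness of the faces of
    the unit cube.

    Jf must be invertible ([smooth_jacobian_unit]). Otherwise there is a
    nonzero v with Jf v = 0, and p + t v is a zero of f modulo t^2. Smoothness
    lifts zeros along the square-zero extensions R[t]/(t^{k+1}) -> R[t]/(t^k),
    so p + t v extends to a formal arc on the zero scheme of [f]
    ([smooth_arc]). The polynomials vanishing along this arc form a prime ideal
    that contains [f] and is strictly contained in the maximal ideal of [p], as
    the arc is not constant; this contradicts dimension 0
    ([arc_prime_chain]). *)

Set Implicit Arguments.
Unset Strict Implicit.
Unset Printing Implicit Defensive.

Import Order.TTheory GRing.Theory Num.Theory.
Import numFieldTopology.Exports.

Local Open Scope ring_scope.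

(** * Norms on column vectors and their operator norms *)

Section NormFacts.
Variables (R : realType) (n : nat) (N : 'cV[R]_n -> R).
Hypothesis hN : is_norm N.

Lemma is_norm0 : N 0 = 0.
Proof. by case: hN => _ NZ _; rewrite -(scale0r 0) NZ normr0 mul0r. Qed.

Lemma is_normN v : N (- v) = N v.
Proof. by case: hN => _ NZ _; rewrite -scaleN1r NZ normrN1 mul1r. Qed.

Lemma is_norm_ge0 v : 0 <= N v.
Proof.
case: hN => _ _ ND; have := ND v (- v).
by rewrite subrr is_norm0 is_normN; lra.
Qed.

Lemma is_norm_gt0 v : v != 0 -> 0 < N v.
Proof.
move=> v0; rewrite lt_def is_norm_ge0 andbT.
by apply: contra_neq v0; case: hN => + _ _; apply.
Qed.

Lemma is_norm_sum (I : finType) (F : I -> 'cV[R]_n) :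
  N (\sum_i F i) <= \sum_i N (F i).
Proof.
case: hN => _ _ ND; elim/big_rec2: _ => [|i a u _ ua].
  by rewrite is_norm0.
by apply: le_trans (ND _ _) _; rewrite lerD2l.
Qed.

Lemma is_norm_le_coord (v : 'cV[R]_n) e : (forall i, `|v i 0| <= e) ->
  N v <= e * \sum_i N (delta_mx i 0).
Proof.
move=> ve; rewrite {1}[v]matrix_sum_delta mulr_sumr.
apply: le_trans (is_norm_sum _) _; apply: ler_sum => i _.
case: hN => _ NZ _; rewrite big_ord1 NZ.
by apply: ler_wpM2r; rewrite ?is_norm_ge0.
Qed.

Lemma is_norm_dist u v : `|N u - N v| <= N (u - v).
Proof.
case: hN => _ _ ND; rewrite ler_norml.
have := ND (u - v) v; have := ND (v - u) u.
by rewrite !subrK -(opprB u v) is_normN; lra.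
Qed.

Local Open Scope classical_set_scope.

(** Continuity of [N], in the only form that is used below. Row vectors appear
    because the compactness theorem for products is stated for them. *)
Lemma nbhs_is_norm_gt (v : 'rV[R]_n) : v != 0 ->
  nbhs v [set w | N v^T / 2 < N w^T].
Proof.
move=> v0; have Nv : 0 < N v^T.
  by apply: is_norm_gt0; rewrite -(inj_eq trmx_inj) trmxK trmx0.
pose S := \sum_i N (delta_mx i 0); have S0 : 0 <= S.
  by apply: sumr_ge0 => i _; exact: is_norm_ge0.
pose e := N v^T / 2 / (S + 1); have e0 : 0 < e by rewrite !divr_gt0//; lra.
exists (fun i j => ball (v i j) e) => [i j|w /= vw].
  exact: nbhsx_ballx.
have : N (v^T - w^T) <= e * S.
  apply: is_norm_le_coord => i; rewrite !mxE.
  exact/ltW/vw.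
have := is_norm_dist v^T w^T; rewrite ler_norml => /andP[_ h1 h2].
have : e * S < N v^T / 2 by rewrite /e mulrAC ltr_pdivrMr; [nra|lra].
lra.
Qed.

(** The face of the unit cube where coordinate [i] equals 1. Being a product of
    segments it is compact by Tychonoff, and every nonzero vector is
    proportional to a point of such a face, so that the faces can play the part
    of the unit sphere. *)
Definition cube_face (i : 'I_n) : set 'rV[R]_n :=
  [set v | forall j, `[(if j == i then 1 else - 1), 1]%classic (v ord0 j)].

Lemma compact_cube_face i : compact (cube_face i).
Proof.
have := @matrix_normedtype.rV_compact R n
  (fun j => `[(if j == i then 1 else - 1), 1]%classic).
by apply=> j; exact: normed_module.segment_compact.
Qed.

(** The neighborhoods of [nbhs_is_norm_gt] cover the compact face, and on each
    of them [k * N] is at least 1 for all large [k]. *)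
Lemma is_norm_cube_face i : exists2 C : R, 0 < C &
  forall v, cube_face i v -> 1 <= C * N v^T.
Proof.
have /compact_near_coveringP := @compact_cube_face i.
move=> /(_ nat \oo (fun k v => 1 <= k%:R * N v^T) _)[|k0 _ hk].
  move=> v vF; have v0 : v != 0.
    apply/eqP => v0; have := vF i; rewrite v0 mxE eqxx /= in_itv /=; lra.
  have Nv : 0 < N v^T.
    by apply: is_norm_gt0; rewrite -(inj_eq trmx_inj) trmxK trmx0.
  pose k0 := Num.truncn (2 / N v^T).
  exists ([set w | N v^T / 2 < N w^T], [set k | (k0 < k)%N]).
    by split; [exact: nbhs_is_norm_gt | exists k0.+1].
  move=> [w k] [/= hw hk].
  have Nv2 : 0 <= 2 / N v^T by rewrite divr_ge0 // ltW.
  have : 2 / N v^T < k%:R by rewrite -truncn_lt_nat.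
  rewrite ltr_pdivrMr //; nra.
exists (k0.+1%:R); first by rewrite ltr0n.
by move=> v; apply: (hk k0.+1) => /=.
Qed.

(** Half of the equivalence of norms in finite dimension: scaling [v] by the
    inverse of its largest coordinate moves it to a face of the cube. *)
Lemma coord_le_is_norm :
  exists C : R, forall (v : 'cV[R]_n) i, `|v i 0| <= C * N v.
Proof.
case: (hN) => _ NZ _.
have /choice[C hC] : forall i, exists C : R,
    0 < C /\ forall v, cube_face i v -> 1 <= C * N v^T.
  by move=> i; have [C] := is_norm_cube_face i; exists C.
have C0 i : 0 < C i by case: (hC i).
exists (\sum_i C i) => v i.
have [j _ /= vj] := arg_maxP (fun j => `|v j 0|) (erefl : xpredT i).
(* [j] is the index of a coordinate of largest absolute value. *)
apply: le_trans (vj i erefl) _.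
have [-> | vj0] := eqVneq (v j 0) 0.
  by rewrite normr0 mulr_ge0 ?is_norm_ge0 // sumr_ge0 // => k _; exact/ltW.
have /(hC j).2 : cube_face j ((v j 0)^-1 *: v)^T.
  move=> k; rewrite /= in_itv /= !mxE; case: eqP => [->|_].
    by rewrite mulVf ?lexx.
  by rewrite -ler_norml normrM normfV ler_pdivrMl ?normr_gt0 // mulr1;
    exact: vj.
rewrite trmxK NZ normfV mulrCA ler_pdivlMl ?normr_gt0 // mulr1.
move=> /le_trans; apply.
apply: ler_wpM2r; first exact: is_norm_ge0.
by rewrite (bigD1 j) //= lerDl sumr_ge0 // => k _; exact/ltW.
Qed.

(** The supremum of an unbounded set is 0 by convention, so [opnormP] rests on
    this bound. *)
Lemma opnorm_has_ubound (M : 'M[R]_n) :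
  has_ubound [set N (M *m v) | v in [set v | N v = 1]].
Proof.
have [C hC] := coord_le_is_norm.
exists (\sum_j C * N (col j M)) => _ [v /= Nv <-].
have -> : M *m v = \sum_j v j 0 *: col j M.
  apply/colP => i; rewrite mxE summxE; apply: eq_bigr => j _.
  by rewrite !mxE mulrC.
apply: le_trans (is_norm_sum _) _; apply: ler_sum => j _.
case: hN => _ -> _; apply: ler_wpM2r; first exact: is_norm_ge0.
by have := hC v j; rewrite Nv mulr1.
Qed.

Lemma opnormP (M : 'M[R]_n) (v : 'cV[R]_n) : N (M *m v) <= opnorm N M * N v.
Proof.
have [->|v0] := eqVneq v 0; first by rewrite mulmx0 is_norm0 mulr0.
have Nv := is_norm_gt0 v0; case: (hN) => _ NZ _.
rewrite -ler_pdivrMr //; apply: ub_le_sup; first exact: opnorm_has_ubound.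
exists ((N v)^-1 *: v); rewrite -?scalemxAr /= NZ ger0_norm ?invr_ge0 ?ltW //.
  by rewrite mulVf ?gt_eqF.
by rewrite mulrC.
Qed.

Lemma opnorm_ge0 (M : 'M[R]_n) : 0 <= opnorm N M.
Proof.
rewrite /opnorm; set S := (X in sup X).
have [->|/set0P[x Sx]] := eqVneq S set0; first by rewrite sup0.
apply: le_trans (ub_le_sup (opnorm_has_ubound M) Sx).
by case: Sx => v _ <-; exact: is_norm_ge0.
Qed.

End NormFacts.

(** The bound is that of the Neumann series, but it follows from the inequality
    ||(1 + A) v|| >= (1 - ||A||) ||v||, which also makes 1 + A injective. *)
Lemma neumann_bound (R : realType) n (N : 'cV[R]_n -> R) (A : 'M[R]_n) :
  is_norm N -> opnorm N A < 1 ->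
  1%:M + A \in unitmx /\
  forall v : 'cV[R]_n, N (invmx (1%:M + A) *m v) <= N v / (1 - opnorm N A).
Proof.
move=> hN A1.
have lb (v : 'cV[R]_n) : (1 - opnorm N A) * N v <= N ((1%:M + A) *m v).
  case: (hN) => _ _ ND; have := ND ((1%:M + A) *m v) (- (A *m v)).
  rewrite is_normN // mulmxDl mul1mx addrK; have := opnormP hN A v; lra.
have uA : 1%:M + A \in unitmx.
  rewrite -unitmx_tr unitmxE unitfE; apply/det0P => -[w w0 Aw].
  have := lb w^T; rewrite -[_ *m _]trmxK trmx_mul trmxK Aw trmx0 is_norm0 //.
  rewrite pmulr_rle0 ?subr_gt0 // leNgt is_norm_gt0 //.
  by rewrite -(inj_eq trmx_inj) trmxK trmx0.
split=> // v; rewrite ler_pdivlMr ?subr_gt0 // mulrC.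
by apply: le_trans (lb _) _; rewrite mulmxA mulmxV // mul1mx.
Qed.

(** * Taylor expansion at a point *)

Section Taylor.
Variables (R : numFieldType) (n : nat) (a : 'I_n -> R).
Implicit Types (g h q : {mpoly R[n]}) (m : 'X_{1..n}).

(** The polynomial g(X + a), whose coefficients are the Taylor coefficients of
    [g] at [a]. *)
Definition recenter g : {mpoly R[n]} :=
  g \mPo [tuple 'X_i + (a i)%:MP | i < n].

Lemma mderiv_recenter i g : (recenter g)^`M(i) = recenter g^`M(i).
Proof.
(* The set of the [h] that satisfy the claim is closed under ring operations. *)
pose Q h := (recenter h)^`M(i) = recenter h^`M(i).
have QM h h' : Q h -> Q h' -> Q (h * h').
  rewrite /Q /recenter => Qh Qh'.
  by rewrite rmorphM /= !mderivM Qh Qh' raddfD /= !rmorphM.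
have Q1 : Q 1 by rewrite /Q /recenter comp_mpoly1 -mpolyC1 !mderivC comp_mpoly0.
have QX j : Q 'X_j.
  rewrite /Q /recenter comp_mpolyXU -tnth_nth tnth_mktuple mderivD mderivC addr0.
  rewrite !mderivX comp_mpolyZ comp_mpolyX.
  rewrite mnm1E; case: eqP => [->|]; last by rewrite !scale0r.
  have -> : (U_(i) - U_(i) = 0 :> 'X_{1..n})%MM.
    by apply/mnmP=> k; rewrite mnmBE mnm0E subnn.
  by rewrite mpolyX0 big1 ?scaler1 => [|k _]; rewrite ?mnm0E ?expr0.
rewrite -/(Q g); elim/mpolyind: g => [|c m h _ _ Qh].
  by rewrite /Q /recenter comp_mpoly0 !mderiv0 comp_mpoly0.
have Qm : Q 'X_[m].
  rewrite mpolyXE_id; apply: (big_ind Q) => // j _.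
  by elim: (m j) => [|k IHk]; rewrite ?expr0 // exprS; exact: QM.
rewrite /Q /recenter comp_mpolyD comp_mpolyZ !mderivD !mderivZ.
by rewrite comp_mpolyD comp_mpolyZ -/(recenter _) Qm -/(recenter h) Qh.
Qed.

Lemma mderivm_recenter m g : (recenter g)^`M[m] = recenter g^`M[m].
Proof.
rewrite !mderivm_foldr; elim: (flatten _) => //= i s ->.
exact: mderiv_recenter.
Qed.

(** Evaluation takes its values in an arbitrary commutative ring over [R]: the
    Taylor formula is needed both at real points and at points of R[t]. *)
Section Evaluation.
Variables (S : comNzRingType) (f : {rmorphism R -> S}).

Lemma mmap_comp_mpoly (y : 'I_n -> S) (lq : n.-tuple {mpoly R[n]}) g :
  mmap f y (g \mPo lq) = mmap f (fun i => mmap f y (tnth lq i)) g.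
Proof.
rewrite comp_mpolyEX [X in _ = mmap _ _ X](mpolyE g) !raddf_sum /=.
apply/eq_bigr => m _; rewrite !mmapZ; congr *%R.
rewrite comp_mpolyX rmorph_prod /= mmapX.
by apply/eq_bigr=> i _; rewrite rmorphXn.
Qed.

Lemma mmap_ext (y y' : 'I_n -> S) g : y =1 y' -> mmap f y g = mmap f y' g.
Proof. by move=> e; apply: eq_bigr => m _; rewrite (mmap1_eq _ e). Qed.

Lemma mmap_recenter (u : 'I_n -> S) g :
  mmap f u (recenter g) = mmap f (fun i => f (a i) + u i) g.
Proof.
rewrite mmap_comp_mpoly; apply: mmap_ext => i.
by rewrite tnth_mktuple raddfD /= mmapX mmap1U mmapC addrC.
Qed.
End Evaluation.

Lemma mcoeff0_meval h : h@_0 = h.@[fun=> 0].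
Proof.
rewrite [in RHS](mpolyE h) [in LHS](mpolyE h) !raddf_sum /=.
apply: eq_bigr => m _; rewrite mcoeffZ mevalZ mcoeffX mevalX; congr (_ * _).
have [->|m0] := eqVneq m 0%MM; first by rewrite big1 // => i _; rewrite mnm0E.
have [i mi] : exists i, m i != 0%N.
  apply/existsP; apply: contra_neqT m0; rewrite negb_exists => /forallP m0.
  by apply/mnmP => i; rewrite mnm0E; apply/eqP; have := m0 i; rewrite negbK.
by rewrite (bigD1 i) //= expr0n (negPf mi) mul0r.
Qed.

(** Derivatives commute with translations, so the constant term of the [m]-th
    derivative of [recenter g] can be computed in two ways. *)
Lemma mcoeff_recenter m g :
  (recenter g)@_m = (\prod_i (m i)`!)%N%:R^-1 * (g^`M[m]).@[a].
Proof.
have fact0 : (\prod_i (m i)`!)%N%:R != 0 :> R.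
  by rewrite pnatr_eq0 -lt0n prodn_gt0 // => i; rewrite fact_gt0.
have : (recenter g)^`M[m]@_0 = (g^`M[m]).@[a].
  rewrite mderivm_recenter mcoeff0_meval /meval mmap_recenter.
  by apply: mmap_ext => i; rewrite addr0.
rewrite mcoeff_mderivm addm0 => <-.
have -> : (\prod_i m i ^_ m i = \prod_i (m i)`!)%N.
  by apply: eq_bigr => i _; exact: ffactnn.
by rewrite -[X in _ * X]mulr_natl mulKf.
Qed.

Lemma mderivm_eq0 m g : (msize g <= mdeg m)%N -> g^`M[m] = 0.
Proof.
move=> gm; apply/mpolyP => m'; rewrite mcoeff_mderivm mcoeff0.
rewrite memN_msupp_eq0 ?mul0rn // msize_mdeg_ge // mdegD.
exact: leq_trans gm (leq_addr _ _).
Qed.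

Lemma msize_recenter g : (msize (recenter g) <= msize g)%N.
Proof.
rewrite mmeasureE; apply/bigmax_leqP_seq => m + _.
rewrite mcoeff_msupp mcoeff_recenter; apply: contraR; rewrite -leqNgt => gm.
by rewrite mderivm_eq0 // meval0 mulr0.
Qed.

(** The part of degree at least 2 in [X - a] of the expansion of [g], written in
    the centered variable. *)
Definition tail2 g : {mpoly R[n]} :=
  \sum_(m : 'X_{1..n < msize g} | (2 <= mdeg m)%N) (recenter g)@_m *: 'X_[m].

(** Compared coefficient by coefficient; the truncation at [msize g] in [tail2]
    loses nothing because the translate of [g] has no larger degree. *)
Lemma recenter_split g :
  recenter g = (g.@[a])%:MP + \sum_j (g^`M(j)).@[a] *: 'X_j + tail2 g.
Proof.
pose E m := if (2 <= mdeg m)%N then (recenter g)@_m else 0.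
have -> : tail2 g = \sum_(m : 'X_{1..n < msize g}) E m *: 'X_[m].
  rewrite /tail2 big_mkcond; apply: eq_bigr => m _; rewrite /E.
  by case: ifP => //; rewrite scale0r.
have E0 m : (msize g <= mdeg m)%N -> (recenter g)@_m = 0.
  move=> gm; apply: memN_msupp_eq0; apply: msize_mdeg_ge.
  exact: leq_trans (msize_recenter g) gm.
apply/mpolyP => m.
rewrite !mcoeffD mcoeffC.
have -> : (\sum_(m : 'X_{1..n < msize g}) E m *: 'X_[m])@_m = E m.
  have [mg|gm] := ltnP (mdeg m) (msize g); first exact: mcoeff_mpoly.
  rewrite raddf_sum /= big1 => [|k _]; first by rewrite /E E0 ?if_same.
  rewrite mcoeffZ mcoeffX; case: eqP => [km|]; last by rewrite mulr0.
  by have := bmdeg k; rewrite km ltnNge gm.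
have -> : (\sum_j (g^`M(j)).@[a] *: 'X_j)@_m =
    \sum_j (g^`M(j)).@[a] * (U_(j)%MM == m)%:R.
  by rewrite raddf_sum; apply: eq_bigr => j _; rewrite /= mcoeffZ mcoeffX.
rewrite /E; case: (ltngtP 1%N (mdeg m)) => [m2|/ltnSE|m1].
- rewrite big1 => [|j _].
    have /negPf-> : m != 0%MM by rewrite -mdeg_eq0; case: mdeg m2.
    by rewrite mulr0 !add0r.
  case: eqP => [jm|]; last by rewrite mulr0.
  by rewrite -jm mdeg1 in m2.
- rewrite leqn0 mdeg_eq0 => /eqP ->; rewrite eqxx mulr1 addr0 big1 => [|j _].
    rewrite addr0 mcoeff_recenter mderivm0m big1 ?invr1 ?mul1r // => i _.
    by rewrite mnm0E.
  by rewrite mnm1_eq0 mulr0.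
have /existsP[j /eqP ->] : [exists i, m == U_(i)%MM] by rewrite -mdeg_eq1 -m1.
rewrite mnm1_eq0 mulr0 add0r addr0 (bigD1 j) //= big1 => [|k kj].
  rewrite addr0 eqxx mulr1 mcoeff_recenter mderivmU1m.
  by rewrite big1 ?invr1 ?mul1r // => i _; rewrite mnm1E; case: eqP.
by rewrite eq_mnm1 (negPf kj) mulr0.
Qed.

(** The polynomial identity [recenter_split], evaluated at the increment [u]. *)
Lemma mmap_taylor (S : comNzRingType) (f : {rmorphism R -> S})
    (u : 'I_n -> S) g :
  mmap f (fun i => f (a i) + u i) g =
  f g.@[a] + \sum_j f (g^`M(j)).@[a] * u j + mmap f u (tail2 g).
Proof.
rewrite -mmap_recenter recenter_split !raddfD /= mmapC; congr (_ + _ + _).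
rewrite (raddf_sum (mmap f u)).
by apply: eq_bigr => j _; rewrite /= mmapZ mmapX mmap1U.
Qed.

End Taylor.

Section TaylorPoint.
Variables (R : realType) (n : nat).
Implicit Types (f : 'I_n -> {mpoly R[n]}) (p x : 'cV[R]_n).

Lemma taylor_ge2_tail2 (g : {mpoly R[n]}) x p :
  taylor_ge 2 g x p = (tail2 (pt p) g).@[fun i => x i 0 - p i 0].
Proof.
rewrite /tail2 raddf_sum; apply: eq_bigr => m _ /=.
by rewrite mevalZ mevalX mcoeff_recenter.
Qed.

Lemma taylor1 (g : {mpoly R[n]}) x p :
  g.@[pt x] = g.@[pt p] + \sum_j (g^`M(j)).@[pt p] * (x j 0 - p j 0)
              + taylor_ge 2 g x p.
Proof.
rewrite taylor_ge2_tail2 -[RHS](mmap_taylor (pt p) idfun).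
by apply: mmap_ext => i; rewrite addrC subrK.
Qed.

(** For a zero [p] of [f] the right-hand side is [- jacobian f p *m p], which is
    how the two Taylor remainders enter the estimate. *)
Lemma evalv0_sub_taylor f p :
  evalv f 0 - taylor_gev 2 f 0 p = evalv f p - jacobian f p *m p.
Proof.
apply/colP => i; rewrite !mxE (taylor1 (f i) 0 p) addrK; congr (_ + _).
rewrite -sumrN; apply: eq_bigr => j _.
by rewrite !mxE sub0r mulrN.
Qed.

End TaylorPoint.

(** * Arcs on the zero scheme and invertibility of the Jacobian matrix *)

(** The value of a polynomial along the curve [y] with parameter ['X]. *)
Definition ev (K : fieldType) (n : nat) (y : 'I_n -> {poly K}) :
  {mpoly K[n]} -> {poly K} := mmap polyC y.

Section TangentVector.
Variables (K : numFieldType) (n : nat) (a v : 'I_n -> K).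

Lemma dvdp_tail2 (g : {mpoly K[n]}) :
  'X^2 %| ev (fun i => v i *: 'X) (tail2 a g).
Proof.
rewrite /ev /tail2 (raddf_sum (mmap _ _)) /=.
apply: (big_ind (fun q => 'X^2 %| q)) => [|p q|m m2].
- exact: dvdp0.
- exact: dvdp_add.
rewrite mmapZ mmapX /mmap1 dvdp_mull //.
under eq_bigr do rewrite exprZn.
rewrite scaler_prod -expr_sum -mdegE /=.
by rewrite -mul_polyC dvdp_mull // dvdp_exp2l.
Qed.

(** The linear term of the Taylor expansion along [v] vanishes, and the higher
    ones are divisible by t^2: a kernel vector of the differential gives a zero
    over the dual numbers. *)
Lemma dvdp_tangent (g : {mpoly K[n]}) :
  g.@[a] = 0 -> \sum_j (g^`M(j)).@[a] * v j = 0 ->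
  'X^2 %| ev (fun i => (a i)%:P + v i *: 'X) g.
Proof.
move=> ga dg; rewrite /ev mmap_taylor ga add0r.
rewrite (eq_bigr (fun j => ((g^`M(j)).@[a] * v j) *: 'X)) => [|j _]; last first.
  by rewrite mul_polyC scalerA.
by rewrite -scaler_suml dg scale0r add0r; exact: dvdp_tail2.
Qed.
End TangentVector.

Section Arcs.
Variables (K : fieldType) (n : nat).
Implicit Types (f : 'I_n -> {mpoly K[n]}) (g : {mpoly K[n]}).
Implicit Types (y : 'I_n -> {poly K}) (q : {poly K}) (k : nat).

HB.instance Definition _ y := GRing.RMorphism.copy (ev y) (mmap polyC y).

Lemma in_qpolyXnE k q : in_qpoly 'X^(k.+1) q = q %% 'X^(k.+1) :> {poly K}.
Proof.
by rewrite /= mk_monic_Xn /= -Pdiv.IdomainMonic.modpE ?monicXn.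
Qed.

Lemma in_qpolyXn_eq0 k q :
  (in_qpoly 'X^(k.+1) q == 0 :> {poly %/ 'X^(k.+1)}) = ('X^(k.+1) %| q).
Proof. by rewrite -val_eqE /dvdp -in_qpolyXnE. Qed.

Lemma qpolyXnK k (z : {poly %/ 'X^(k.+1) : {poly K}}) :
  in_qpoly 'X^(k.+1) z = z.
Proof. by apply: val_inj; apply: in_qpoly_small; exact: size_mk_monic. Qed.

Lemma dvdp_in_qpolyXn k l q : (l <= k.+1)%N ->
  ('X^l %| (in_qpoly 'X^(k.+1) q : {poly K})) = ('X^l %| q).
Proof.
move=> lk; rewrite in_qpolyXnE [in RHS](divp_eq q 'X^(k.+1)).
by rewrite dvdp_addr // dvdp_mull // dvdp_exp2l.
Qed.

(** Relates [ev] to the evaluation of the polynomial with coefficients in the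
    algebra K[t]/(h), which is what [smooth_scheme] speaks about. *)
Lemma in_qpoly_ev (h : {poly K}) y g :
  in_qpoly h (ev y g) =
  (map_mpoly (in_alg {poly %/ h}) g).@[fun i => in_qpoly h (y i)].
Proof.
rewrite /ev /mmap rmorph_sum [in RHS](mpolyE g) (raddf_sum (map_mpoly _)).
rewrite (raddf_sum (meval _)) /=.
apply: eq_bigr => m _; rewrite map_mpolyZ map_mpolyX mevalZ mevalX.
rewrite rmorphM rmorph_prod /=; congr (_ * _).
  by rewrite -alg_polyC linearZ /= rmorph1.
by apply: eq_bigr => i _; rewrite rmorphXn.
Qed.

Lemma ev_congr k y y' g : (forall j, 'X^(k.+1) %| y' j - y j) ->
  'X^(k.+1) %| ev y' g - ev y g.
Proof.
move=> yy'; rewrite -in_qpolyXn_eq0 rmorphB /= subr_eq0 !in_qpoly_ev.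
apply/eqP; apply: meval_eq => j; apply/eqP.
by rewrite -subr_eq0 -rmorphB in_qpolyXn_eq0.
Qed.

(** The ideal (t^(k+1)) of K[t]/(t^(k+2)) has square zero, so smoothness lifts a
    zero modulo t^(k+1) to a zero modulo t^(k+2). *)
Lemma smooth_lift f k y : smooth_scheme f ->
  (forall i, 'X^(k.+1) %| ev y (f i)) ->
  exists y', (forall j, 'X^(k.+1) %| y' j - y j) /\
             forall i, 'X^(k.+2) %| ev y' (f i).
Proof.
move=> smf fy; pose C : comAlgType K := {poly %/ 'X^(k.+2) : {poly K}}.
pose J : {pred C} := fun z => 'X^(k.+1) %| (z : {poly K}).
have JE q : (in_qpoly 'X^(k.+2) q \in J) = ('X^(k.+1) %| q).
  exact: dvdp_in_qpolyXn.
have sqJ : square_zero_ideal J.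
  split; first split.
  - exact: dvdp0.
  - rewrite -(rmorph1 (in_qpoly 'X^(k.+2))) JE; apply/negP => /dvdp_leq.
    by rewrite oner_eq0 size_polyXn size_poly1 => /(_ isT).
  - move=> b u v Ju Jv; rewrite -(qpolyXnK b) -(qpolyXnK u) -(qpolyXnK v).
    by rewrite -rmorphM -rmorphD JE dvdp_add // dvdp_mull.
  - move=> u v Ju Jv; rewrite -(qpolyXnK u) -(qpolyXnK v) -rmorphM.
    apply/eqP; rewrite in_qpolyXn_eq0.
    apply: dvdp_trans (dvdp_mul Ju Jv).
    by rewrite -exprD dvdp_exp2l // addSn addnS !ltnS leq_addl.
have [z zy fz] : exists2 z : 'I_n -> C,
    forall j, z j - in_qpoly 'X^(k.+2) (y j) \in J
  & forall i, (map_mpoly (in_alg C) (f i)).@[z] = 0.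
  by apply: (smf C J sqJ) => i; rewrite -in_qpoly_ev JE.
exists (fun j => z j : {poly K}); split=> [j|i].
  by rewrite -JE rmorphB /= qpolyXnK; exact: zy.
rewrite -in_qpolyXn_eq0 in_qpoly_ev -[X in _ == X](fz i).
by apply/eqP; apply: meval_eq => j; rewrite qpolyXnK.
Qed.

(** The sequence [Y] stands for the power series arc that is its limit: it
    determines the arc modulo every power of t. Starting modulo t^2 keeps the
    tangent vector of [y0]. *)
Lemma smooth_arc f y0 : smooth_scheme f ->
  (forall i, 'X^2 %| ev y0 (f i)) ->
  exists Y : nat -> 'I_n -> {poly K},
    [/\ Y 0%N = y0,
        forall k j, 'X^(k.+2) %| Y k.+1 j - Y k j
      & forall k i, 'X^(k.+2) %| ev (Y k) (f i)].
Proof.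
move=> smf fy0.
have /choice[s hs] : forall ky : nat * ('I_n -> {poly K}), exists y',
    (forall i, 'X^(ky.1.+2) %| ev ky.2 (f i)) ->
    (forall j, 'X^(ky.1.+2) %| y' j - ky.2 j) /\
    forall i, 'X^(ky.1.+3) %| ev y' (f i).
  move=> [k y] /=; have [fy|fy] := pselect (forall i, 'X^(k.+2) %| ev y (f i)).
    by have [y' hy'] := smooth_lift smf fy; exists y'.
  by exists y => /fy.
pose Y k := iteri k (fun k y => s (k, y)) y0.
have fY k i : 'X^(k.+2) %| ev (Y k) (f i).
  elim: k i => [|k IHk] //; exact: (hs (k, Y k) IHk).2.
by exists Y; split=> // k j; exact: (hs (k, Y k) (fY k)).1.
Qed.

(** Additivity of the order of vanishing at 0; it makes the ideal of an arc
    prime. *)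
Lemma dvdXn_mul i j (u v : {poly K}) : 'X^(i + j) %| u * v ->
  ('X^i %| u) || ('X^j %| v).
Proof.
elim: i u => [|i IHi] u; first by rewrite expr0 dvd1p.
have [/dvdpP[w ->]|Xu] := boolP ('X %| u).
  rewrite addSn exprSr mulrAC dvdp_mul2r ?polyX_eq0 //.
  by rewrite exprSr dvdp_mul2r ?polyX_eq0 //; exact: IHi.
have ux : coprimep 'X^(i.+1 + j) u.
  rewrite coprimep_expl // coprimep_sym coprimepX -dvdp_XsubCl.
  by rewrite polyC0 subr0.
rewrite Gauss_dvdpr // => uv; rewrite (dvdp_trans _ uv) ?orbT //.
by rewrite dvdp_exp2l // leq_addl.
Qed.

(** The order of vanishing of [g] along the arc, truncated at [k + 2], can be
    read off any [Y l] with [l >= k]. *)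
Lemma arc_stable (Y : nat -> 'I_n -> {poly K}) g k l :
  (forall k j, 'X^(k.+2) %| Y k.+1 j - Y k j) -> (k <= l)%N ->
  ('X^(k.+2) %| ev (Y l) g) = ('X^(k.+2) %| ev (Y k) g).
Proof.
move=> dY /subnKC <-; elim: (l - k)%N => [|d IHd]; first by rewrite addn0.
rewrite -{}IHd addnS -[ev (Y (k + d).+1) g](subrK (ev (Y (k + d)%N) g)).
rewrite dvdp_addr //; apply: dvdp_trans (ev_congr _ (dY _)).
by rewrite dvdp_exp2l // !ltnS leq_addr.
Qed.

Lemma horner0_ev y g : (ev y g).[0] = g.@[fun i => (y i).[0]].
Proof.
rewrite /ev /mmap horner_sum; apply: eq_bigr => m _.
rewrite hornerM hornerC; congr (_ * _).
by rewrite horner_prod; apply: eq_bigr => i _; rewrite horner_exp.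
Qed.

(** The chain consists of the polynomials that vanish along the arc and those
    that vanish at its origin [a]. Coordinate [j], which is not constant to
    first order along the arc, shows that the inclusion is strict. *)
Lemma arc_prime_chain f (a : 'I_n -> K) (Y : nat -> 'I_n -> {poly K}) j :
  (forall i, (Y 0%N i).[0] = a i) ->
  ~~ ('X^2 %| Y 0%N j - (a j)%:P) ->
  (forall k i, 'X^(k.+2) %| Y k.+1 i - Y k i) ->
  (forall k i, 'X^(k.+2) %| ev (Y k) (f i)) ->
  prime_chain f 1.
Proof.
move=> Ya Yj dY fY.
pose P0 : {pred {mpoly K[n]}} :=
  fun g => `[< forall k, 'X^(k.+2) %| ev (Y k) g >].
pose P1 : {pred {mpoly K[n]}} := fun g => g.@[a] == 0.
have P01 : {subset P0 <= P1}.
  move=> g /asboolP/(_ 0%N) Yg; rewrite /P1 unfold_in /=.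
  rewrite -(meval_eq _ Ya) -horner0_ev.
  have : 'X %| ev (Y 0%N) g by apply: dvdp_trans Yg; rewrite dvdp_exp.
  by rewrite -['X]subr0 -polyC0 dvdp_XsubCl.
have fP0 i : f i \in P0 by apply/asboolP.
have primeP1 : prime_ideal P1.
  split; first split; rewrite ?unfold_in /=.
  - by rewrite raddf0.
  - by rewrite rmorph1 oner_eq0.
  - move=> b u v; rewrite !unfold_in /= => /eqP u0 /eqP v0.
    by rewrite rmorphD rmorphM /= u0 v0 mulr0 addr0.
  - by move=> u v; rewrite !unfold_in /= rmorphM mulf_eq0.
have primeP0 : prime_ideal P0.
  split; first split.
  - by apply/asboolP => k; rewrite rmorph0 dvdp0.
  - by apply: (contra (P01 1)); case: primeP1 => - [].
  - move=> b u v /asboolP Yu /asboolP Yv; apply/asboolP => k.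
    by rewrite rmorphD rmorphM dvdp_add // dvdp_mull.
  - move=> u v /asboolP Yuv; apply: contraT; rewrite negb_or.
    move=> /andP[/asboolP/existsNP[k uk] /asboolP/existsNP[l vl]].
    (* The product vanishes to order (k + 2) + (l + 2), so one factor already
       vanishes to the order that was excluded for it. *)
    have := Yuv (k + l.+2)%N; rewrite -addSn -addSn rmorphM => /dvdXn_mul.
    have lk : (l <= k + l.+2)%N 
      by rewrite !addnS; do 2!apply: leqW; exact: leq_addl.
    by rewrite !arc_stable ?leq_addr // => /orP[/uk|/vl].
exists (fun k => if k is 0%N then P0 else P1); split.
  by move=> [|k] _; split=> // i; exact: P01.
move=> [|k] // _; split=> //; exists ('X_j - (a j)%:MP).
  by rewrite unfold_in /= raddfB /= mevalXU mevalC subrr.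
apply/asboolP => /(_ 0%N); rewrite rmorphB /= /ev mmapX mmap1U mmapC.
exact/negP.
Qed.

End Arcs.

(** A kernel vector [w] of the Jacobian would be the velocity at [p] of a
    nonconstant arc on the zero scheme of [f], whose dimension is 0. *)
Lemma smooth_jacobian_unit (R : realType) n (f : 'I_n -> {mpoly R[n]})
    (p : 'cV[R]_n) :
  smooth_zero_dim_complete_intersection f -> real_zeros f p ->
  jacobian f p \in unitmx.
Proof.
move=> [[_ nochain] smf] fp; apply: contraT => Jp; case: nochain.
have /det0P[w w0 Jw] : \det (jacobian f p)^T == 0.
  by rewrite det_tr; move: Jp; rewrite unitmxE unitfE negbK.
have [j wj] : exists j, w 0 j != 0.
  apply/existsP; apply: contra_neqT w0; rewrite negb_exists => /forallP w0.
  by apply/rowP => j; rewrite mxE; apply/eqP; have := w0 j; rewrite negbK.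
pose y0 i : {poly R} := (pt p i)%:P + w 0 i *: 'X.
have [|Y [Y0 dY fY]] := smooth_arc (y0 := y0) smf.
  move=> i; apply: dvdp_tangent; first exact: fp.
  have /rowP/(_ i) := Jw; rewrite mxE [RHS]mxE => Jwi; rewrite -[RHS]Jwi.
  by apply: eq_bigr => k _; rewrite !mxE mulrC.
apply: (arc_prime_chain (a := pt p) (j := j)) dY fY => [i|].
  by rewrite Y0 /y0 !hornerE.
rewrite Y0 /y0 addrC addKr; apply/negP => /dvdp_leq.
rewrite scaler_eq0 polyX_eq0 orbF => /(_ wj).
by rewrite size_polyXn size_scale // size_polyX.
Qed.

(** * The estimate *)

Lemma jacobianD (R : realType) n (f g : 'I_n -> {mpoly R[n]}) (p : 'cV[R]_n) :
  jacobian (fun i => f i + g i) p = jacobian f p + jacobian g p.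
Proof. by apply/matrixP => i j; rewrite !mxE mderivD mevalD. Qed.

Theorem theorem3p15 (R : realType) (n : nat) (f eps : 'I_n -> {mpoly R[n]})
    (p : 'cV[R]_n) (N : 'cV[R]_n -> R)
    (hf : smooth_zero_dim_complete_intersection f)
    (heps : admissible_perturbation f eps)
    (hp0 : p <> 0) (hp : real_zeros f p)
    (hN : is_norm N)
    (hlt : opnorm N (invmx (jacobian f p) *m jacobian eps p) < 1) :
  N (Delta1 f eps p) / N p <=
    Lambda N f eps p * kappa N f p *
    (opnorm N (jacobian eps p) / opnorm N (jacobian f p)
     + N (evalv eps 0 - taylor_gev 2 eps 0 p)
       / N (evalv f 0 - taylor_gev 2 f 0 p)).
Proof.
rewrite /Lambda /kappa /Delta1 jacobianD is_normN //.
have uJ := smooth_jacobian_unit hf hp.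
rewrite (evalv0_sub_taylor f); have -> : evalv f p = 0.
  by apply/colP => i; rewrite !mxE hp.
rewrite sub0r is_normN //.
(* The perturbation at [p] splits into the two terms of the estimate. *)
have epsp :
    evalv eps p = evalv eps 0 - taylor_gev 2 eps 0 p + jacobian eps p *m p.
  by rewrite evalv0_sub_taylor subrK.
set J := jacobian f p in uJ hlt *; set E := jacobian eps p in hlt epsp *.
set w := evalv eps 0 - _ in epsp *.
have [uA hA] := neumann_bound hN hlt.
have -> : invmx (J + E) *m evalv eps p =
    invmx (1%:M + invmx J *m E) *m (invmx J *m (w + E *m p)).
  rewrite epsp mulmxA; congr (_ *m _).
  have -> : J + E = J *m (1%:M + invmx J *m E).
    by rewrite mulmxDr mulmx1 mulmxA mulmxV // mul1mx.
  have uJA : J *m (1%:M + invmx J *m E) \in unitmx by rewrite unitmx_mul uJ.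
  apply: (can_inj (mulKmx uJA)); rewrite mulmxV //.
  by rewrite mulmxA -(mulmxA J) mulmxV // mulmx1 mulmxV.
have p0 : p != 0 by exact/eqP.
have Np := is_norm_gt0 hN p0.
have NJp : 0 < N (J *m p).
  apply: is_norm_gt0 => //; apply: contra_neq p0 => Jp.
  by rewrite -(mulKmx uJ p) Jp mulmx0.
have hJp := opnormP hN J p.
have hEp := opnormP hN E p.
have hJi := opnormP hN (invmx J) (w + E *m p).
have Ji0 := opnorm_ge0 hN (invmx J).
have := hA (invmx J *m (w + E *m p)).
have Nw := is_norm_ge0 hN w.
have J0 : 0 < opnorm N J by rewrite -(pmulr_lgt0 _ Np); exact: lt_le_trans hJp.
have hwE : N (w + E *m p) <= N w + opnorm N E * N p.
  by case: (hN) => _ _ ND; apply: le_trans (ND _ _) _; rewrite lerD2l.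
set L := 1 - opnorm N _; have L0 : 0 < L by rewrite subr_gt0.
set a := opnorm N (invmx J) in Ji0 hJi *; set b := opnorm N J in J0 hJp *.
set e := opnorm N E in hEp hwE *; set d := N (J *m p) in NJp hJp *.
(* The bound [d <= b * N p] is applied to the last factor of [N w / d * d]. *)
have key : N w + e * N p <= b * (e / b + N w / d) * N p.
  have -> : b * (e / b + N w / d) * N p = N w / d * (b * N p) + e * N p.
    by field; rewrite !gt_eqF.
  rewrite lerD2r -{1}(divfK (lt0r_neq0 NJp) (N w)) ler_wpM2l //.
  by rewrite divr_ge0 // ltW.
move=> h; rewrite ler_pdivrMr //; apply: (le_trans h).
have -> : 1 / L * (a * b) * (e / b + N w / d) * N p
    = a * (b * (e / b + N w / d) * N p) / L by ring.
rewrite ler_pM2r ?invr_gt0 //; apply: (le_trans hJi); apply: ler_wpM2l => //.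
exact: le_trans key.
Qed.
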